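(* There is an algorithm which, given a graph $G$ that is (theta, wheel)-free together with a weight function $w:V(G)\to[0,+\infty)$, outputs a maximum weight clique of $G$, i.e. a clique $K$ maximizing $\sum_{v\in K}w(v)$, in time $\mathcal O(n^2m)$, where $n=|V(G)|$ and $m=|E(G)|$.
   Context: All graphs are finite and simple; ''contains'' means contains as an induced subgraph. A hole is a chordless cycle of length at least 4. A theta is a graph formed by three paths between the same pair of distinct vertices such that the union of any two of the paths induces a hole. A wheel is a graph formed by a hole and a vertex that has at least 3 neighbors in the hole. A graph is (theta, wheel)-free if it contains no theta and no wheel as an induced subgraph. A clique is a set of pairwise adjacent vertices. *)

(* Defs.v *)
From HB Require Import structures.
From mathcomp Require Import all_boot all_order all_algebra.
From mathcomp Require Import reals.

Set Implicit Arguments.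
Unset Strict Implicit.
Unset Printing Implicit Defensive.

Import Order.TTheory GRing.Theory Num.Theory.

(** * Graphs *)

(* A finite simple graph is a symmetric irreflexive relation [e] on a finite
   type. *)

Section Graphs.
Variables (T : finType) (e : rel T).

(* Consecutive vertices of [c], the last one being followed by the first. *)
Definition consecutive (c : seq T) (x y : T) := (y == next c x) || (x == next c y).

(* [c] lists the vertices of a hole in cyclic order. *)
Definition hole (c : seq T) : Prop :=
  [/\ ucycle e c, 4 <= size c &
      {in c &, forall x y, e x y -> consecutive c x y}].

(* [q] lists the interior vertices of a path of the graph from [a] to [b]. *)
Definition path_between (a b : T) (q : seq T) : Prop :=
  path e a (rcons q b) /\ uniq (a :: rcons q b).

(* The union of the [a]-[b] paths with interiors [q1] and [q2] is a hole: it is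
   a cycle, traversed by following the first path from [a] to [b] and coming
   back to [a] along the second one, and this cycle is chordless in the graph.
   In particular the two paths are internally disjoint. *)
Definition union_is_hole (a b : T) (q1 q2 : seq T) : Prop :=
  hole (a :: q1 ++ b :: rev q2).

(* Every edge between vertices of the three paths lies within the union of two
   of them, hence, the holes being chordless in the graph, it is an edge of one
   of the paths: the vertices of the paths induce exactly the theta. *)
Definition contains_theta : Prop :=
  exists (a b : T) (q1 q2 q3 : seq T),
    [/\ a != b,
        [/\ path_between a b q1, path_between a b q2 & path_between a b q3] &
        [/\ union_is_hole a b q1 q2, union_is_hole a b q1 q3
          & union_is_hole a b q2 q3]].

Definition contains_wheel : Prop :=
  exists (c : seq T) (x : T),
    [/\ hole c, x \notin c & 3 <= #|[set y in c | e x y]|].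

Definition theta_wheel_free : Prop := ~ contains_theta /\ ~ contains_wheel.

Definition clique (K : {set T}) : Prop :=
  {in K &, forall x y, x != y -> e x y}.

Definition max_weight_clique (R : realType) (w : T -> R) (K : {set T}) : Prop :=
  clique K /\
  forall K' : {set T}, clique K' ->
    (\sum_(v in K') w v <= \sum_(v in K) w v)%R.

End Graphs.

Definition num_edges n (e : rel 'I_n) : nat :=
  #|[set xy : 'I_n * 'I_n | (xy.1 < xy.2) && e xy.1 xy.2]|.

(** * Algorithms: programs for a unit-cost real RAM

  Programs are written in a structured (while) language. The memory consists of
  arrays, named by natural numbers, some with
  natural-number cells and some with real cells; array names are constants of
  the program and scalars are cells of arrays at constant indices. On naturals
  the machine has only constants, addition, truncated subtraction and
  comparison (neither multiplication nor bitwise operations, so large numbers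
  cannot be used to compute in parallel); on reals it has only the constant 0,
  addition, subtraction and comparison, and no conversion to naturals. The
  graph is given by its adjacency matrix, one entry of which is read by [BAdj].
  Programs contain no real constant but 0, and depend neither on the graph nor
  on the weights. *)

Inductive nexp : Type :=
| NConst of nat
| NGet of nat & nexp               (* NGet a i: cell i of natural array a *)
| NAdd of nexp & nexp
| NSub of nexp & nexp.

Inductive rexp : Type :=
| RZero
| RGet of nat & nexp               (* RGet a i: cell i of real array a *)
| RAdd of rexp & rexp
| RSub of rexp & rexp.

Inductive bexp : Type :=
| BNle of nexp & nexp
| BRle of rexp & rexp
| BAdj of nexp & nexp
| BNot of bexp
| BAnd of bexp & bexp.

Inductive cmd : Type :=
| Skip
| NSet of nat & nexp & nexp        (* NSet a i x: store x in cell i of a *)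
| RSet of nat & nexp & rexp
| Seq of cmd & cmd
| If of bexp & cmd & cmd
| While of bexp & cmd.

(* The cost of an evaluation is the number of nodes of the expression: all of
   them are evaluated, [BAnd] not being lazy. *)

Fixpoint ncost (x : nexp) : nat :=
  match x with
  | NConst _ => 1
  | NGet _ i => (ncost i).+1
  | NAdd x1 x2 | NSub x1 x2 => (ncost x1 + ncost x2).+1
  end.

Fixpoint rcost (x : rexp) : nat :=
  match x with
  | RZero => 1
  | RGet _ i => (ncost i).+1
  | RAdd x1 x2 | RSub x1 x2 => (rcost x1 + rcost x2).+1
  end.

Fixpoint bcost (b : bexp) : nat :=
  match b with
  | BNle x1 x2 | BAdj x1 x2 => (ncost x1 + ncost x2).+1
  | BRle x1 x2 => (rcost x1 + rcost x2).+1
  | BNot b1 => (bcost b1).+1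
  | BAnd b1 b2 => (bcost b1 + bcost b2).+1
  end.

Section Semantics.
Variables (R : realType) (n : nat) (e : rel 'I_n).

Record state : Type := State {
  nmem : nat -> nat -> nat;        (* array name, index *)
  rmem : nat -> nat -> R
}.

Definition update (A : Type) (m : nat -> nat -> A) (a i : nat) (x : A) :
    nat -> nat -> A :=
  fun b j => if (b == a) && (j == i) then x else m b j.

(* Adjacency-matrix entries outside the matrix read as non-adjacent. *)
Definition adj (i j : nat) : bool :=
  match insub i, insub j with
  | Some u, Some v => e u v
  | _, _ => false
  end.

Fixpoint neval (s : state) (x : nexp) : nat :=
  match x with
  | NConst k => k
  | NGet a i => nmem s a (neval s i)
  | NAdd x1 x2 => neval s x1 + neval s x2
  | NSub x1 x2 => neval s x1 - neval s x2
  end.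

Fixpoint reval (s : state) (x : rexp) : R :=
  match x with
  | RZero => 0%R
  | RGet a i => rmem s a (neval s i)
  | RAdd x1 x2 => (reval s x1 + reval s x2)%R
  | RSub x1 x2 => (reval s x1 - reval s x2)%R
  end.

Fixpoint beval (s : state) (b : bexp) : bool :=
  match b with
  | BNle x1 x2 => neval s x1 <= neval s x2
  | BRle x1 x2 => (reval s x1 <= reval s x2)%R
  | BAdj x1 x2 => adj (neval s x1) (neval s x2)
  | BNot b1 => ~~ beval s b1
  | BAnd b1 b2 => beval s b1 && beval s b2
  end.

(* [exec c s t s']: started in [s], the command [c] terminates in [s'] after
   [t] steps. *)
Inductive exec : cmd -> state -> nat -> state -> Prop :=
| ExecSkip s :
    exec Skip s 1 s
| ExecNSet s a i x :
    exec (NSet a i x) s (ncost i + ncost x).+1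
      (State (update (nmem s) a (neval s i) (neval s x)) (rmem s))
| ExecRSet s a i x :
    exec (RSet a i x) s (ncost i + rcost x).+1
      (State (nmem s) (update (rmem s) a (neval s i) (reval s x)))
| ExecSeq c1 c2 s1 s2 s3 t1 t2 :
    exec c1 s1 t1 s2 -> exec c2 s2 t2 s3 ->
    exec (Seq c1 c2) s1 (t1 + t2) s3
| ExecIfTrue b c1 c2 s t s' :
    beval s b -> exec c1 s t s' ->
    exec (If b c1 c2) s (bcost b + t).+1 s'
| ExecIfFalse b c1 c2 s t s' :
    ~~ beval s b -> exec c2 s t s' ->
    exec (If b c1 c2) s (bcost b + t).+1 s'
| ExecWhileFalse b c s :
    ~~ beval s b ->
    exec (While b c) s (bcost b).+1 s
| ExecWhileTrue b c s1 s2 s3 t1 t2 :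
    beval s1 b -> exec c s1 t1 s2 -> exec (While b c) s2 t2 s3 ->
    exec (While b c) s1 (bcost b + t1 + t2).+1 s3.

(* Initially cell 0 of natural array 0 holds [n], real array 0 holds the
   weights of the vertices, and every other cell holds 0. *)
Definition init_state (w : 'I_n -> R) : state :=
  State (fun a i => if (a == 0) && (i == 0) then n else 0)
        (fun a i => if a == 0 then oapp w 0%R (insub i) else 0%R).

(* The output is read from natural array 1, as a characteristic vector. *)
Definition output (s : state) : {set 'I_n} :=
  [set v : 'I_n | nmem s 1 v != 0].

End Semantics.

(* Main.v *)
(* In a wheel-free graph the closed neighborhood of every vertex [v] contains no
   hole, and every nonempty clique lies in the closed neighborhood of one of its
   vertices. So it suffices to run, for each [v], a maximum cardinality search on
   the closed neighborhood [D] of [v]: repeatedly visit a vertex [x] of [D] with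
   the largest number of visited neighbors. The visited set [S] stays separated:
   no chordless path joins two vertices of [S] through a nonempty interior in
   [D] minus [S]. Hence [x] and its visited neighbors form a clique, which
   contains every clique of [D] whose last visited vertex is [x]. Each visit
   updates the counts and selects the next vertex in time O(n), so that the total
   time is O(n (n + m)). *)
Require Import Defs.
From mathcomp Require Import all_boot all_order all_algebra.
From mathcomp Require Import reals.
From mathcomp Require Import zify.

Set Implicit Arguments.
Unset Strict Implicit.
Unset Printing Implicit Defensive.

Import Order.TTheory GRing.Theory Num.Theory.

(** * Chordless paths and maximum cardinality search *)

Section ChordlessPaths.
Variables (T : finType) (e : rel T).
Hypothesis (esym : symmetric e) (eirr : irreflexive e).

(** Stated by positions, so that a single equation gives both the edges of the path and the absence
    of chords. *)
Definition chordless_path (s : seq T) : Prop :=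
  uniq s /\ forall x0 i j, i < j -> j < size s ->
    e (nth x0 s i) (nth x0 s j) = (j == i.+1).

Lemma chordless_path_rev (s : seq T) : chordless_path s -> chordless_path (rev s).
Proof.
move=> [us es]; split=> [|x0 i j ij]; first by rewrite rev_uniq.
rewrite size_rev => js; have is_ := ltn_trans ij js.
rewrite !nth_rev // esym es; [|lia|lia].
by apply/eqP/eqP; lia.
Qed.

Lemma hole_nth (c : seq T) :
    uniq c -> 4 <= size c ->
    (forall x0 i j, i < j -> j < size c ->
       e (nth x0 c i) (nth x0 c j) =
         (j == i.+1) || ((i == 0) && (j == (size c).-1))) ->
  hole e c.
Proof.
case: c => // x p uc sc ec; split=> //.
  rewrite /ucycle uc andbT; apply/(pathP x) => i.
  rewrite size_rcons ltnS nth_rcons => ip.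
  rewrite -rcons_cons nth_rcons /= ltnS ip.
  move: ip; rewrite leq_eqVlt => /orP[/eqP ->|ip].
    rewrite ltnn eqxx esym.
    by have := ec x 0 (size p); rewrite /= eqxx orbT; apply=> //; case: (p) sc.
  by rewrite ip (ec x i i.+1) // eqxx.
have next_c i j : i < j -> j < size (x :: p) ->
    e (nth x (x :: p) i) (nth x (x :: p) j) ->
    consecutive (x :: p) (nth x (x :: p) i) (nth x (x :: p) j).
  move=> ij js; have is_ := ltn_trans ij js.
    rewrite (ec x) // => /orP[/eqP ->|/andP[/eqP -> /eqP ->]].
    rewrite /consecutive; apply/orP; left; rewrite next_nth mem_nth ?index_uniq //.
  rewrite /consecutive; apply/orP; right; rewrite next_nth mem_nth ?index_uniq //=.
  by rewrite (nth_default x (leqnn _)).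
move=> y z /(nthP x)[i ic <-] /(nthP x)[j jc <-].
case: (ltngtP i j) => [ij|ji|->]; first exact: next_c.
  by rewrite esym => /next_c; rewrite /consecutive orbC; apply.
by rewrite eirr.
Qed.

(** Otherwise [c] would consist of [x] and its two cyclic neighbors, three vertices at most. *)
Lemma hole_nonneighbor (c : seq T) x :
  hole e c -> x \in c -> exists y, [/\ y \in c, y != x & ~~ e x y].
Proof.
move=> [/andP[_ uc] sc cc] xc.
have [y /and3P[yc yx exy]|none] :=
  pickP [pred y | [&& y \in c, y != x & ~~ e x y]]; first by exists y.
suff /(uniq_leq_size uc) : {subset c <= [:: x; next c x; prev c x]}.
  by rewrite leqNgt sc.
move=> y yc; rewrite !inE; have := none y; rewrite /= yc /=.
case: eqVneq => //= _ /negbFE /(cc _ _ xc yc)/orP[-> //|/eqP ->].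
by rewrite prev_next // eqxx orbT.
Qed.

(** If [v] lies on the hole, it has a non-neighbor there; if it does not, it is the center of a
    wheel. *)
Lemma wheel_free_closed_neighborhood (v : T) (c : seq T) :
  ~ contains_wheel e -> hole e c -> ~ {in c, forall y, (y == v) || e v y}.
Proof.
move=> nowheel hc cv; case: (boolP (v \in c)) => vc.
  have [y [yc yv]] := hole_nonneighbor hc vc.
  by have := cv y yc; rewrite (negbTE yv) /= => ->.
apply: nowheel; exists c, v; split=> //.
case: hc => /andP[_ /card_uniqP cc] /ltnW c3 _.
rewrite (leq_trans c3) // -cc subset_leq_card //; apply/subsetP => y yc.
rewrite inE yc; have /orP[/eqP yv|//] := cv y yc.
by rewrite -yv yc in vc.
Qed.

(** * Separated sets and their growth under maximum cardinality search *)

Definition neighbors_in (S : {set T}) (x : T) : {set T} := [set y in S | e x y].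

Definition separated (D S : {set T}) : Prop :=
  forall a p b, a \in S -> b \in S -> p != [::] -> {subset p <= D :\: S} ->
  ~ chordless_path (a :: rcons p b).

Lemma separated0 D : separated D set0.
Proof. by move=> a p b; rewrite inE. Qed.

(** Two nonadjacent neighbors of [x] in [S] would be joined by a chordless path with interior
    [x]. *)
Lemma separated_clique (D S : {set T}) x :
  separated D S -> x \in D :\: S -> clique e (x |: neighbors_in S x).
Proof.
move=> sep xDS.
have nb y z : y \in neighbors_in S x -> z \in neighbors_in S x -> y != z -> e y z.
  rewrite !inE => /andP[yS xy] /andP[zS xz] yz; apply/negP => /negP nyz.
  apply: (sep y [:: x] z) => // [u|]; first by rewrite inE => /eqP ->.
  move: xDS; rewrite inE => /andP[xS _].
  split=> [|x0 [|[|[|i]]] [|[|[|j]]] //= _ _]; [|by rewrite esym|exact: negbTE].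
  rewrite /= !inE negb_or yz !andbT.
  by apply/andP; split; apply: contraNneq xS; [move=> <-|move=> ->].
move=> y z; rewrite in_setU1 in_setU1.
move=> /predU1P[->|yN] /predU1P[->|zN] yz; last exact: nb.
- by rewrite eqxx in yz.
- by move: zN; rewrite inE => /andP[].
- by move: yN; rewrite inE esym => /andP[].
Qed.

(* A violating path has an end [a] in [S] and, up to reversal, its other end is
   [x]. As its first interior vertex has no more visited neighbors than [x], some
   [d] in [S] is adjacent to [x] and not to that vertex; the path followed from
   [a] up to the first neighbor of [d] closes with [d] into a hole or into a
   path violating the separation of [S]. *)
Lemma separated_mcs (D S : {set T}) x :
    (forall c, {subset c <= D} -> ~ hole e c) -> S \subset D ->
    separated D S -> x \in D :\: S ->
    {in D :\: S, forall y, #|neighbors_in S y| <= #|neighbors_in S x|} ->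
  separated D (x |: S).
Proof.
move=> nohole SD sep xDS xmax.
have xS : x \notin S by move: xDS; rewrite inE => /andP[].
have key a p : a \in S -> p != [::] -> {subset p <= D :\: S} ->
    ~ chordless_path (a :: rcons p x).
  case: p => // y p aS _ pDS [us es].
  have yDS : y \in D :\: S by apply: pDS; rewrite inE eqxx.
  have ay : e a y by rewrite (es a 0 1).
  have ax : e a x = false.
    have := es a 0 (size p).+2 isT; rewrite /= !size_rcons ltnSn => /(_ isT).
    by rewrite nth_rcons ltnn eqxx.
  have [d /and3P[dS xd yd]|none] := pickP [pred d in S | e x d && ~~ e y d]; last first.
    (* Without such a [d], every neighbor of [x] in [S] is one of [y], and [a] is a further neighbor
       of [y]: this contradicts the choice of [x]. *)
    have /proper_card : neighbors_in S x \proper neighbors_in S y.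
      apply/properP; split; last first.
        by exists a; rewrite !inE aS //= ?[e y a]esym ?[e x a]esym ?ay ?ax.
      apply/subsetP => d; rewrite !inE => /andP[dS xd].
      by have := none d; rewrite /= dS xd /= => /negbFE.
    by rewrite ltnNge xmax.
  have [q qE] : exists q, q = rcons (y :: p) x by eexists.
  (* [j] is the position in [q] of the first neighbor of [d]. It exists since [q] ends with [x], and
     is positive since [q] starts with [y]. With [a] put in front, that vertex has position [j.+1],
     and [d] is placed at [j.+2]. *)
  rewrite -qE in us es; set j := find (e d) q.
  have jq : j < size q.
    by rewrite -has_find; apply/hasP; exists x; rewrite 1?esym // qE mem_rcons inE eqxx.
  have j0 : 0 < j by rewrite /j qE /= esym (negbTE yd).
  have sq x0 i : i <= j -> nth x0 (a :: rcons (take j.+1 q) d) i = nth x0 (a :: q) i.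
    by move=> ij; case: i ij => //= i ij;
      rewrite nth_rcons size_takel // ltnS (ltnW ij) nth_take // ltnS ltnW.
  have sq' x0 i : i = j.+1 -> nth x0 (a :: rcons (take j.+1 q) d) i = nth x0 (a :: q) i.
    by move=> ->; rewrite /= nth_rcons size_takel // ltnSn nth_take.
  have sd x0 i : i = j.+2 -> nth x0 (a :: rcons (take j.+1 q) d) i = d.
    by move=> ->; rewrite /= nth_rcons size_takel // ltnn eqxx.
  have sz : size (a :: rcons (take j.+1 q) d) = j.+3.
    by rewrite /= size_rcons size_takel.
  have qDS : {subset q <= D :\: S}.
    by move=> z; rewrite qE mem_rcons inE => /predU1P[-> //|/pDS].
  have tqDS : {subset take j.+1 q <= D :\: S} by move=> z /mem_take/qDS.
  have da : d != a by apply: contraFneq ax => <-; rewrite esym.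
  have uc : uniq (a :: rcons (take j.+1 q) d).
    have /andP[aq uq] : uniq (a :: q) := us.
    rewrite /= mem_rcons inE eq_sym (negbTE da) /= (contra (@mem_take _ _ _ _)) //=.
    rewrite rcons_uniq take_uniq // andbT; apply/negP => /tqDS.
    by rewrite inE dS.
  (* Only the pair of ends [a], [d] is undecided: an edge closes a hole ([0 < j] makes its length at
     least 4), a non-edge leaves a chordless path. *)
  have ec x0 i i' : i < i' -> i' < j.+3 ->
      e (nth x0 (a :: rcons (take j.+1 q) d) i) (nth x0 (a :: rcons (take j.+1 q) d) i')
      = (i' == i.+1) || [&& i == 0, i' == j.+2 & e a d].
    move=> ii'; rewrite ltnS leq_eqVlt => /predU1P[i'E|i'j].
      rewrite (sd _ i') // i'E eqxx /= eqSS.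
      case: i i'E ii' => [|i] i'E ii' //=.
      rewrite i'E !ltnS in ii'; rewrite /= orbF nth_rcons size_takel // ltnS ii' nth_take //.
      rewrite eqSS; move: ii'; rewrite leq_eqVlt => /predU1P[->|ij].
        by rewrite esym nth_find ?eqxx // has_find.
      by rewrite esym before_find // gtn_eqF.
    have E x1 k : k < j.+2 -> nth x1 (a :: rcons (take j.+1 q) d) k = nth x1 (a :: q) k.
      rewrite ltnS leq_eqVlt => /predU1P[|]; [exact: sq'|exact: sq].
    rewrite !E //; last exact: ltn_trans i'j.
    rewrite es //; last by rewrite (leq_trans i'j) //= ltnS.
    by rewrite (ltn_eqF i'j) andbF orbF.
  case: (boolP (e a d)) => ad.
    apply: (nohole (a :: rcons (take j.+1 q) d)).
      move=> z; rewrite inE mem_rcons inE => /or3P[/eqP ->|/eqP ->|/tqDS].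
      - exact: (subsetP SD).
      - exact: (subsetP SD).
      by rewrite inE => /andP[].
    apply: hole_nth => // [|x0 i i' ii']; rewrite sz //.
    by move=> i'j; rewrite ec // ad andbT.
  apply: (sep a (take j.+1 q) d) => //.
    by rewrite -size_eq0 size_takel.
  split=> // x0 i i' ii'; rewrite sz => i'j.
  by rewrite ec // (negbTE ad) !andbF orbF.
move=> a p b; rewrite !in_setU1 => aS bS p0 pD.
have {}pD : {subset p <= D :\: S}.
  by move=> z /pD; rewrite !inE negb_or => /andP[/andP[_ ->] ->].
case/predU1P: aS => [->|aS]; case/predU1P: bS => [->|bS].
- by move=> [/=]; rewrite mem_rcons inE eqxx.
- move=> /chordless_path_rev; rewrite rev_cons rev_rcons rcons_cons.
  by apply: key => //; rewrite -?size_eq0 ?size_rev ?size_eq0 // => z; rewrite mem_rev => /pD.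
- exact: key.
- exact: sep.
Qed.

End ChordlessPaths.

(** * Running time of programs *)

Fixpoint loop_free (c : cmd) : bool :=
  match c with
  | Skip | NSet _ _ _ | RSet _ _ _ => true
  | Seq c1 c2 | If _ c1 c2 => loop_free c1 && loop_free c2
  | While _ _ => false
  end.

(** Adding the two branches of [If] avoids a maximum. The value at [While] is a dummy: the bound is
    claimed for loop-free commands. *)
Fixpoint maxcost (c : cmd) : nat :=
  match c with
  | Skip => 1
  | NSet _ i x => (ncost i + ncost x).+1
  | RSet _ i x => (ncost i + rcost x).+1
  | Seq c1 c2 => maxcost c1 + maxcost c2
  | If b c1 c2 => (bcost b + (maxcost c1 + maxcost c2)).+1
  | While _ _ => 0
  end.

Fixpoint nwrites (c : cmd) : seq nat :=
  match c with
  | Skip | RSet _ _ _ => [::]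
  | NSet a _ _ => [:: a]
  | Seq c1 c2 | If _ c1 c2 => nwrites c1 ++ nwrites c2
  | While _ c1 => nwrites c1
  end.

Fixpoint rwrites (c : cmd) : seq nat :=
  match c with
  | Skip | NSet _ _ _ => [::]
  | RSet a _ _ => [:: a]
  | Seq c1 c2 | If _ c1 c2 => rwrites c1 ++ rwrites c2
  | While _ c1 => rwrites c1
  end.

(** * A program logic with time budgets *)

Section ProgramLogic.
Variables (R : realType) (n : nat) (e : rel 'I_n).
Implicit Types (c : cmd) (s : state R) (P Q : state R -> Prop) (T : nat).

(** The effect of a loop-free command as a function, so that loop bodies are treated by
    simplification. *)
Fixpoint step c s : state R :=
  match c with
  | Skip | While _ _ => s
  | NSet a i x => State (update (nmem s) a (neval s i) (neval s x)) (rmem s)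
  | RSet a i x => State (nmem s) (update (rmem s) a (neval s i) (reval s x))
  | Seq c1 c2 => step c2 (step c1 s)
  | If b c1 c2 => if beval e s b then step c1 s else step c2 s
  end.

Definition frame (A B : seq nat) s s' : Prop :=
  (forall a, a \notin A -> nmem s' a = nmem s a) /\
  (forall a, a \notin B -> rmem s' a = rmem s a).

(** A total-correctness triple with time budget [T]. *)
Definition runs T c s Q : Prop :=
  exists t s', [/\ exec e c s t s', t <= T & Q s'].

Lemma adjE (u v : 'I_n) : adj e u v = e u v.
Proof. by rewrite /adj !valK. Qed.

Lemma exec_frame c s t s' :
  exec e c s t s' -> frame (nwrites c) (rwrites c) s s'.
Proof.
have upd (A : Type) (m : nat -> nat -> A) a i x b :
    b \notin [:: a] -> update m a i x b = m b.
  by rewrite inE /update => /negbTE ->.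
elim=> {c s t s'} //=.
- by move=> s a i x; split=> //= b; exact: upd.
- by move=> s a i x; split=> //= b; exact: upd.
- move=> c1 c2 s1 s2 s3 t1 t2 _ [n12 r12] _ [n23 r23].
  by split=> a; rewrite mem_cat negb_or => /andP[a1 a2]; rewrite ?n23 ?r23 ?n12 ?r12.
- move=> s b c1 c2 t s' _ _ [nE rE].
  by split=> a; rewrite mem_cat negb_or => /andP[a1 a2]; rewrite ?nE ?rE.
- move=> s b c1 c2 t s' _ _ [nE rE].
  by split=> a; rewrite mem_cat negb_or => /andP[a1 a2]; rewrite ?nE ?rE.
- move=> b c s1 s2 s3 t1 t2 _ _ [n12 r12] _ [n23 r23].
  by split=> a aA; rewrite ?n23 ?r23 ?n12 ?r12.
Qed.

Lemma runs_frame T c s Q :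
  runs T c s Q ->
  runs T c s (fun s' => frame (nwrites c) (rwrites c) s s' /\ Q s').
Proof.
by move=> [t [s' [x tT q]]]; exists t, s'; split=> //; split=> //; exact: exec_frame x.
Qed.

Lemma runs_weaken T T' c s P Q :
  T' <= T -> (forall s', P s' -> Q s') -> runs T' c s P -> runs T c s Q.
Proof.
by move=> TT PQ [t [s' [x tT q]]]; exists t, s'; split; [|exact: leq_trans TT|exact: PQ].
Qed.

Lemma runs_seq T1 T2 c1 c2 s P Q :
  runs T1 c1 s P -> (forall s', P s' -> runs T2 c2 s' Q) ->
  runs (T1 + T2) (Seq c1 c2) s Q.
Proof.
move=> [t1 [s1 [x1 le1 p]]] /(_ _ p)[t2 [s2 [x2 le2 q]]].
by exists (t1 + t2), s2; split=> //; [exact: ExecSeq x1 x2|exact: leq_add].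
Qed.

Lemma runs_if T b c1 c2 s Q :
  (beval e s b -> runs T c1 s Q) -> (~~ beval e s b -> runs T c2 s Q) ->
  runs (bcost b + T).+1 (If b c1 c2) s Q.
Proof.
move=> r1 r2; case: (boolP (beval e s b)) => sb.
  have [t [s' [x tT q]]] := r1 sb.
  by exists (bcost b + t).+1, s'; split; [exact: ExecIfTrue|rewrite ltnS leq_add2l|].
have [t [s' [x tT q]]] := r2 sb.
by exists (bcost b + t).+1, s'; split; [exact: ExecIfFalse|rewrite ltnS leq_add2l|].
Qed.

(* [Inv T s] reads: from the state [s], a budget of [T] steps suffices. *)
Lemma runs_while (Inv : nat -> state R -> Prop) T b c s Q :
    (forall T s, Inv T s -> ~~ beval e s b -> bcost b < T /\ Q s) ->
    (forall T s, Inv T s -> beval e s b ->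
       exists T1 T2, (bcost b + T1 + T2).+1 <= T /\ runs T1 c s (Inv T2)) ->
  Inv T s -> runs T (While b c) s Q.
Proof.
(* The budget itself is the termination measure: every iteration costs at least one step. *)
move=> exit body; elim/ltn_ind: T s => T IH s inv.
case: (boolP (beval e s b)) => sb.
  have [T1 [T2 [leT [t1 [s1 [x1 le1 inv1]]]]]] := body _ _ inv sb.
  have [|t2 [s2 [x2 le2 q]]] := IH T2 _ s1 inv1.
    by rewrite (leq_trans _ leT) // ltnS leq_addl.
  exists (bcost b + t1 + t2).+1, s2; split=> //; first exact: ExecWhileTrue x1 x2.
  by rewrite (leq_trans _ leT) // ltnS leq_add // leq_add2l.
have [leT q] := exit _ _ inv sb.
by exists (bcost b).+1, s; split=> //; exact: ExecWhileFalse.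
Qed.

Lemma runs_loop_free c s Q :
  loop_free c -> Q (step c s) -> runs (maxcost c) c s Q.
Proof.
elim: c s Q => //=.
- by move=> s Q _ q; exists 1, s; split=> //; exact: ExecSkip.
- by move=> a i x s Q _ q; do 2 eexists; split; [exact: ExecNSet| |].
- by move=> a i x s Q _ q; do 2 eexists; split; [exact: ExecRSet| |].
- move=> c1 IH1 c2 IH2 s Q /andP[f1 f2] q.
  by apply: runs_seq (IH1 s (eq (step c1 s)) f1 erefl) _ => _ <-; exact: IH2.
- move=> b c1 IH1 c2 IH2 s Q /andP[f1 f2] q.
  apply: runs_if => sb.
    apply: runs_weaken (IH1 s Q f1 _); rewrite ?leq_addr //.
    by rewrite sb in q.
  apply: runs_weaken (IH2 s Q f2 _); rewrite ?leq_addl //.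
  by rewrite (negbTE sb) in q.
Qed.

End ProgramLogic.

(* Natural arrays 2, 3 and 4 hold at index 0 the variables [v], [u] and [x]. *)
Definition bound := NGet 0 (NConst 0).
Definition var_v := NGet 2 (NConst 0).
Definition var_u := NGet 3 (NConst 0).
Definition var_x := NGet 4 (NConst 0).

Definition incr a := NSet a (NConst 0) (NAdd (NGet a (NConst 0)) (NConst 1)).
Definition below a := BNot (BNle bound (NGet a (NConst 0))).

Definition for_u (c : cmd) : cmd :=
  Seq (NSet 3 (NConst 0) (NConst 0)) (While (below 3) (Seq c (incr 3))).

(** The overhead 13 of an iteration is 6 for the test, 6 for the increment and 1 for the loop; the
    extra iteration pays for the initialization (3) and the last test (7). *)
Definition for_cost (c : cmd) n : nat := (maxcost c + 13) * n.+1.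

(** The frames supply what the body leaves unchanged, so [Inv] need only describe the arrays it
    writes. Array 3 is excepted because the counter is incremented after the body. *)
Lemma runs_for_u (R : realType) n (e : rel 'I_n) (Inv : nat -> state R -> Prop) c s :
    loop_free c -> 0 \notin nwrites c -> 3 \notin nwrites c ->
    nmem s 0 0 = n ->
    (forall s1, frame [:: 3] [::] s s1 -> Inv 0 s1) ->
    (forall (i : 'I_n) s1 s2, frame (3 :: nwrites c) (rwrites c) s s1 ->
       nmem s1 3 0 = i -> Inv i s1 ->
       frame [:: 3] [::] (step e c s1) s2 -> Inv i.+1 s2) ->
  runs e (for_cost c n) (for_u c) s (Inv n).
Proof.
move=> lf w0 w3 sn inv0 invS.
pose J T s1 := exists2 i, i <= n & [/\ T = (maxcost c + 13) * (n - i) + 7,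
   nmem s1 3 0 = i, frame (3 :: nwrites c) (rwrites c) s s1 & Inv i s1].
have nE s1 : frame (3 :: nwrites c) (rwrites c) s s1 -> nmem s1 0 0 = n.
  by case=> fr _; rewrite fr ?inE ?negb_or.
have stepE (s1 : state R) a : a \notin nwrites c -> nmem (step e c s1) a = nmem s1 a.
  move=> ac;
  have [t [s' [x _ ->]]] :=
    runs_loop_free (e := e) (s := s1) lf (erefl (step e c s1)).
  by have [-> ] := exec_frame x.
have stepE' (s1 : state R) a : a \notin rwrites c -> rmem (step e c s1) a = rmem s1 a.
  move=> ac;
  have [t [s' [x _ ->]]] :=
    runs_loop_free (e := e) (s := s1) lf (erefl (step e c s1)).
  by have [_ -> ] := exec_frame x.
set s0 := step e (NSet 3 (NConst 0) (NConst 0)) s.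
have fr0 : frame [:: 3] [::] s s0.
  by split=> //= a; rewrite inE /update => /negbTE ->.
have W : runs e ((maxcost c + 13) * n + 7) (While (below 3) (Seq c (incr 3))) s0 (Inv n).
  apply: (runs_while (Inv := J)).
  - move=> T s1 [i le_in [-> s1u fr inv]].
    rewrite /= nE // s1u negbK => le_ni; split; first by rewrite addnC; lia.
    by have -> : n = i by apply/eqP; rewrite eqn_leq le_ni.
  - move=> T s1 [i le_in [-> s1u fr inv]].
    rewrite /= nE // s1u -ltnNge => lt_in.
    exists (maxcost (Seq c (incr 3))), ((maxcost c + 13) * (n - i.+1) + 7); split.
      by rewrite -(subnSK lt_in) mulnS /=; lia.
    apply: runs_loop_free; first by rewrite /= lf.
    exists i.+1 => //; split=> //.
    + by rewrite /= /update /= (stepE _ _ w3) s1u addn1.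
    + case: fr => frn frr; split=> a /=.
        rewrite inE negb_or => /andP[a3 ac]; rewrite /update (negbTE a3) /=.
        by rewrite stepE // frn // inE negb_or a3.
      by move=> ac; rewrite stepE' // frr.
    + apply: (invS (Ordinal lt_in) s1) => //; split=> //= a.
      by rewrite inE /update => /negbTE ->.
  - exists 0 => //; split=> //; [by rewrite subn0| |exact: inv0].
    case: fr0 => frn frr; split=> a; last by move=> _; rewrite frr.
    by rewrite inE negb_or => /andP[a3 _]; rewrite frn // inE.
apply: (runs_weaken (T' := 3 + ((maxcost c + 13) * n + 7))); last 2 first.
- by move=> s' H; exact: H.
- by apply: runs_seq (runs_loop_free (Q := eq s0) _ _) _ => // _ <-.
by rewrite /for_cost; nia.
Qed.

(** * The algorithm *)

(* Natural array 5 holds the keys: 0 for the vertices that are visited or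
   outside the closed neighborhood of [v], and one more than the number of
   visited neighbors for the others. The cell of index [n] stays at 0, so that
   [x = n] stands for "no vertex". Natural array 6 marks the visited vertices;
   real array 1 holds the total weight of the visited neighbors, and real
   array 2 the weight of the best clique found. *)
Definition key i := NGet 5 i.
Definition visited i := NGet 6 i.
Definition weight i := RGet 0 i.
Definition nbr_weight i := RGet 1 i.
Definition best := RGet 2 (NConst 0).

Definition start_body : cmd :=
  Seq (If (BAdj var_v var_u) (NSet 5 var_u (NConst 1)) (NSet 5 var_u (NConst 0)))
      (Seq (NSet 6 var_u (NConst 0)) (RSet 1 var_u RZero)).

(** The key of [v] is set after the loop, which only follows adjacency to [v]; [v] is the first
    vertex to visit. *)
Definition start : cmd :=
  Seq (for_u start_body) (Seq (NSet 5 var_v (NConst 1)) (NSet 4 (NConst 0) var_v)).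

Definition candidate := RAdd (nbr_weight var_x) (weight var_x).

Definition record_body : cmd :=
  If (BAnd (BNle (NConst 1) (visited var_u)) (BAdj var_x var_u))
     (NSet 1 var_u (NConst 1)) (NSet 1 var_u (NConst 0)).

(** This runs before [x] is marked as visited, whence the separate assignment for [x]. *)
Definition record : cmd :=
  If (BRle candidate best) Skip
     (Seq (RSet 2 (NConst 0) candidate)
          (Seq (for_u record_body) (NSet 1 var_x (NConst 1)))).

(** A key 0 must stay 0, lest a visited or outside vertex become a candidate; the weights of visited
    neighbors are updated regardless. *)
Definition visit_body : cmd :=
  If (BAdj var_x var_u)
     (Seq (RSet 1 var_u (RAdd (nbr_weight var_u) (weight var_x)))
          (If (BNle (NConst 1) (key var_u))
              (NSet 5 var_u (NAdd (key var_u) (NConst 1))) Skip))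
     Skip.

Definition visit : cmd :=
  Seq (Seq (NSet 5 var_x (NConst 0)) (NSet 6 var_x (NConst 1))) (for_u visit_body).

Definition pick_next_body : cmd :=
  If (BNle (key var_u) (key var_x)) Skip (NSet 4 (NConst 0) var_u).

(** From [n], of key 0, [x] moves only to strictly larger keys; so it ends at [n] exactly when all
    keys are 0. *)
Definition pick_next : cmd := Seq (NSet 4 (NConst 0) bound) (for_u pick_next_body).

Definition search : cmd :=
  Seq start (While (below 4) (Seq record (Seq visit pick_next))).

Definition max_clique : cmd :=
  Seq (NSet 2 (NConst 0) (NConst 0)) (While (below 2) (Seq search (incr 2))).

(** * Specifications and running times of the procedures *)

Section Procedures.
Variables (R : realType) (n : nat) (e : rel 'I_n).
Implicit Type s : state R.

Lemma ltn_ord_neq (i : 'I_n) : (n == i) = false.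
Proof. by apply: gtn_eqF. Qed.

(** The factor 100, here and in the next specifications, is a round bound: the loop bodies have
    [maxcost] at most 32. *)
Lemma start_spec (v : 'I_n) s :
    nmem s 0 0 = n -> nmem s 2 0 = v ->
  runs e (100 * n.+1) start s (fun s' =>
    [/\ nmem s' 4 0 = v, nmem s' 5 n = nmem s 5 n &
        forall u : 'I_n, [/\ nmem s' 5 u = ((u == v) || e v u) :> nat,
          nmem s' 6 u = 0 & rmem s' 1 u = 0%R]]).
Proof.
move=> sn sv.
pose Inv i s1 := nmem s1 5 n = nmem s 5 n /\ forall u : 'I_n, u < i ->
  [/\ nmem s1 5 u = e v u :> nat, nmem s1 6 u = 0 & rmem s1 1 u = 0%R].
have loop : runs e (for_cost start_body n) (for_u start_body) s (Inv n).
  apply: runs_for_u => //.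
    by move=> s1 [fn _]; split=> //; rewrite fn.
  move=> i s1 s2 [fn1 fr1] s1u [inv5 inv] [fn2 fr2].
  have s1v : nmem s1 2 0 = v by rewrite fn1.
  have st u : nmem s2 5 u = if u == i then (e v i : nat) else nmem s1 5 u.
    by rewrite fn2 //= s1u s1v adjE; case: (e v i).
  split=> [|u]; first by rewrite st ltn_ord_neq.
  have st' : nmem s2 6 u = (if u == i :> nat then 0 else nmem s1 6 u) /\
             rmem s2 1 u = (if u == i :> nat then 0%R else rmem s1 1 u).
    by rewrite fn2 //= fr2 //= s1u s1v adjE /update; case: (e v i); rewrite /= ?s1u.
  case: st' => -> ->; rewrite st ltnS leq_eqVlt.
  case: eqVneq => [/val_inj ->|_]; [by move=> _; split|exact: inv].
apply: (runs_weaken (T' := for_cost start_body n + 8)); last 2 first.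
- by move=> s' q; exact: q.
- apply: runs_seq (runs_frame loop) _ => s1 [[fn1 fr1] [inv5 inv]].
  have s1v : nmem s1 2 0 = v by rewrite fn1.
  apply: runs_loop_free => //=; rewrite /update /= s1v; split=> // [|u].
    by rewrite ltn_ord_neq.
  have [-> -> ->] := inv u (ltn_ord u).
  by rewrite -val_eqE; case: eqP => // ->; case: (e v v).
by rewrite /for_cost /=; lia.
Qed.

Lemma record_spec (w : 'I_n -> R) (S : {set 'I_n}) (x : 'I_n) s :
    nmem s 0 0 = n -> nmem s 4 0 = x ->
    (forall u : 'I_n, nmem s 6 u = (u \in S) :> nat) -> x \notin S ->
    (forall u : 'I_n, rmem s 0 u = w u) ->
    rmem s 1 x = (\sum_(y in neighbors_in e S x) w y)%R ->
    clique e (x |: neighbors_in e S x) ->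
    clique e (output n s) -> rmem s 2 0 = (\sum_(y in output n s) w y)%R ->
  runs e (100 * n.+1) record s (fun s' =>
    [/\ clique e (output n s'), rmem s' 2 0 = (\sum_(y in output n s') w y)%R,
        (\sum_(y in x |: neighbors_in e S x) w y <= rmem s' 2 0)%R &
        (rmem s 2 0 <= rmem s' 2 0)%R]).
Proof.
move=> sn sx sS xS sw s1 cliqueN cliqueO sO.
have xN : x \notin neighbors_in e S x by rewrite inE negb_and xS.
have candE : (rmem s 1 x + rmem s 0 x = \sum_(y in x |: neighbors_in e S x) w y)%R.
  by rewrite s1 sw big_setU1 //= addrC.
(* The summands pay for the conditional, the new best weight, the loop writing the clique and the
   assignment for [x]. *)
apply: (runs_weaken (T' := 11 + (9 + (for_cost record_body n + 4)))); last 2 first.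
- by move=> s' q; exact: q.
- rewrite -[11]/(bcost (BRle candidate best)).+1 addSn.
  apply: runs_if; rewrite /= sx candE => le.
    apply: (runs_weaken (T' := 1) _ (fun _ q => q)) => //.
    exact: (runs_loop_free (c := Skip)).
  rewrite -ltNge in le.
  have -> : 9 = maxcost (RSet 2 (NConst 0) candidate) by [].
  apply: runs_seq (runs_loop_free (Q := eq _) _ erefl) _ => // _ <- /=.
  rewrite sx candE.
  set s2 := State _ _.
  pose Inv i s' := forall u : 'I_n, u < i ->
    nmem s' 1 u = (u \in neighbors_in e S x) :> nat.
  have loop : runs e (for_cost record_body n) (for_u record_body) s2 (Inv n).
    apply: runs_for_u => // i s3 s4 [fn3 _] s3u inv [fn4 _] u.
    have -> : nmem s4 1 u = if u == i then (i \in neighbors_in e S x : nat) else nmem s3 1 u.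
      rewrite fn4 //= s3u [nmem s3 6]fn3 // [nmem s3 4]fn3 //= sS sx adjE inE.
      by rewrite lt0b; case: (_ && _).
    case: eqVneq => [->|ui] //.
    by rewrite ltnS leq_eqVlt val_eqE (negbTE ui); exact: inv.
  apply: runs_seq (runs_frame loop) _ => s3 [[fn3 fr3] inv].
  apply: runs_loop_free => //=.
  set s4 := State _ _.
  have outE : output n s4 = x |: neighbors_in e S x.
    apply/setP => u; rewrite in_setU1 inE /= /update /= [nmem s3 4]fn3 //= sx.
    rewrite val_eqE; have [//|_] := eqVneq u x.
    by rewrite inv // eqb0 negbK.
  by rewrite outE fr3 //= /update /=; split=> //; exact: ltW.
by rewrite /for_cost /=; lia.
Qed.

Lemma visit_spec (w : 'I_n -> R) (x : 'I_n) s :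
    nmem s 0 0 = n -> nmem s 4 0 = x ->
    (forall u : 'I_n, rmem s 0 u = w u) ->
  runs e (100 * n.+1) visit s (fun s' =>
    [/\ nmem s' 5 n = nmem s 5 n,
        forall u : 'I_n, nmem s' 5 u =
          if (u == x) || (nmem s 5 u == 0) then 0 else nmem s 5 u + e x u,
        forall u : 'I_n, nmem s' 6 u = if u == x then 1 else nmem s 6 u &
        forall u : 'I_n, rmem s' 1 u = (rmem s 1 u + if e x u then w x else 0)%R]).
Proof.
move=> sn sx sw.
apply: (runs_weaken (T' := 8 + for_cost visit_body n)); last 2 first.
- by move=> s' q; exact: q.
- have -> : 8 = maxcost (Seq (NSet 5 var_x (NConst 0)) (NSet 6 var_x (NConst 1))) by [].
  apply: runs_seq (runs_loop_free (Q := eq _) _ erefl) _ => // _ <- /=.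
  rewrite sx; set s1 := State _ _.
  have s1K u : nmem s1 5 u = if u == x then 0 else nmem s 5 u.
    by rewrite /= /update /=.
  (* Vertices from [i] on are described too, since the next iteration updates an old value. *)
  pose Inv i s' := nmem s' 5 n = nmem s1 5 n /\ forall u : 'I_n,
    nmem s' 5 u = (if (u < i) && e x u && (0 < nmem s1 5 u)
                   then (nmem s1 5 u).+1 else nmem s1 5 u) /\
    rmem s' 1 u = (rmem s1 1 u + if (u < i)%N && e x u then w x else 0)%R.
  have loop : runs e (for_cost visit_body n) (for_u visit_body) s1 (Inv n).
    apply: runs_for_u => // [s2 [fn2 fr2]|i s2 s3 [fn2 fr2] s2u [inv5 inv] [fn3 fr3]].
      by split=> [|u]; rewrite fn2 // fr2 //= addr0.
    have s2x : nmem s2 4 0 = x by rewrite fn2.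
    have s2w u : rmem s2 0 u = rmem s 0 u by rewrite fr2.
    have stK u : nmem s3 5 u = if (u == i) && e x i && (0 < nmem s2 5 i)
        then (nmem s2 5 i).+1 else nmem s2 5 u.
      rewrite fn3 //= s2u s2x adjE.
      case: (e x i) => /=; last by rewrite andbF.
      rewrite andbT; case: (0 < _); rewrite ?andbF //= andbT.
      by rewrite addn1.
    have stW u : rmem s3 1 u = if (u == i) && e x i
        then (rmem s2 1 i + w x)%R else rmem s2 1 u.
      rewrite fr3 //= s2u s2x adjE.
      case: (e x i); rewrite ?andbT ?andbF //=.
      by case: ifP => _ /=; rewrite s2w sw.
    split=> [|u]; first by rewrite stK ltn_ord_neq.
    have [iK iW] := inv u.
    have -> : (u < i.+1)%N = (u == i) || (u < i)%N by rewrite ltnS leq_eqVlt.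
    rewrite stK stW iK iW val_eqE; case: eqVneq => [ui|] //=.
    rewrite -ui iK iW ui ltnn /= addr0.
    by case: (e x i); rewrite ?addr0.
  apply: runs_weaken (runs_frame loop) => // s' [[fn' _] [inv5 inv]]; split.
  - by rewrite inv5 s1K ltn_ord_neq.
  - move=> u; have [-> _] := inv u; rewrite ltn_ord andTb !s1K val_eqE.
    case: eqP => //= _; first by rewrite andbF.
    case: eqP => [->|/eqP]; first by rewrite andbF.
    by rewrite -lt0n => ->; rewrite andbT; case: (e x u); rewrite ?addn1 ?addn0.
  - by move=> u; rewrite fn' //= /update /= sx val_eqE.
  - by move=> u; have [_ ->] := inv u; rewrite ltn_ord.
by rewrite /for_cost /=; lia.
Qed.

Lemma pick_next_spec s :
    nmem s 0 0 = n -> nmem s 5 n = 0 ->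
  runs e (100 * n.+1) pick_next s (fun s' =>
    [/\ nmem s' 4 0 <= n, nmem s' 4 0 < n -> 0 < nmem s 5 (nmem s' 4 0) &
        forall u : 'I_n, nmem s 5 u <= nmem s 5 (nmem s' 4 0)]).
Proof.
move=> sn s5.
apply: (runs_weaken (T' := 4 + for_cost pick_next_body n)); last 2 first.
- by move=> s' q; exact: q.
- have -> : 4 = maxcost (NSet 4 (NConst 0) bound) by [].
  apply: runs_seq (runs_loop_free (Q := eq _) _ erefl) _ => // _ <- /=.
  rewrite sn; set s1 := State _ _.
  pose Inv i s' := [/\ nmem s' 4 0 <= n, nmem s' 4 0 < n -> 0 < nmem s 5 (nmem s' 4 0) &
        forall u : 'I_n, u < i -> nmem s 5 u <= nmem s 5 (nmem s' 4 0)].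
  have loop : runs e (for_cost pick_next_body n) (for_u pick_next_body) s1 (Inv n).
    apply: runs_for_u => // [s2 [fn2 _]|i s2 s3 [fn2 fr2] s2u [le pos mx] [fn3 fr3]].
      by rewrite /Inv fn2 //= /update /= ltnn.
    have s2K : nmem s2 5 = nmem s 5 by rewrite fn2.
    have s3x : nmem s3 4 0 = if nmem s 5 i <= nmem s 5 (nmem s2 4 0)
        then nmem s2 4 0 else i.
      by rewrite fn3 //= s2K s2u; case: ifP => //; rewrite /= /update /= s2u.
    rewrite /Inv s3x; case: (leqP (nmem s 5 i)) => [leK|ltK].
      split=> // u; rewrite ltnS leq_eqVlt => /predU1P[/val_inj -> //|]; exact: mx.
    split=> [|_|u]; [exact: ltnW|exact: leq_ltn_trans ltK|].
    rewrite ltnS leq_eqVlt => /predU1P[/val_inj -> //|/mx ui].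
    exact: leq_trans ui (ltnW ltK).
  by apply: runs_weaken loop => // s' [le pos mx]; split=> // u; exact: mx.
by rewrite /for_cost /=; lia.
Qed.
End Procedures.

(** * Correctness and running time *)

Section Correctness.
Variables (R : realType) (n : nat) (e : rel 'I_n) (w : 'I_n -> R).
Hypotheses (esym : symmetric e) (eirr : irreflexive e).
Hypothesis nowheel : ~ contains_wheel e.
Hypothesis w_ge0 : forall v, (0 <= w v)%R.
Implicit Types (s : state R) (S : {set 'I_n}).

(** * Invariants of the two loops *)

Definition closed_nbhd (v : 'I_n) : {set 'I_n} := [set u | (u == v) || e v u].

(** [P] delimits the cliques accounted for so far; it grows until it covers all nonempty ones. *)
Definition optimal_on (P : {set 'I_n} -> Prop) s : Prop :=
  [/\ clique e (output n s), rmem s 2 0 = (\sum_(y in output n s) w y)%R &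
      forall K, clique e K -> P K -> (\sum_(y in K) w y <= rmem s 2 0)%R].

Definition input_kept s : Prop :=
  [/\ nmem s 0 0 = n, forall u : 'I_n, rmem s 0 u = w u & nmem s 5 n = 0].

Definition scanned k s : Prop :=
  [/\ input_kept s, nmem s 2 0 = k &
      optimal_on (fun K => exists2 u : 'I_n, u < k & u \in K) s].

(** With [picked], the invariant of the inner loop, [S] being the visited set. *)
Definition searching (v : 'I_n) S s : Prop :=
  [/\ input_kept s, nmem s 2 0 = v,
      optimal_on (fun K => (exists2 u : 'I_n, u < v & u \in K) \/ K \subset S) s &
  [/\ S \subset closed_nbhd v, separated e (closed_nbhd v) S,
      forall u : 'I_n, nmem s 5 u =
        if u \in closed_nbhd v :\: S then #|neighbors_in e S u|.+1 else 0,
      forall u : 'I_n, nmem s 6 u = (u \in S) :> nat &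
      forall u : 'I_n, rmem s 1 u = (\sum_(y in neighbors_in e S u) w y)%R]].

Definition picked s : Prop :=
  [/\ nmem s 4 0 <= n, nmem s 4 0 < n -> 0 < nmem s 5 (nmem s 4 0) &
      forall u : 'I_n, nmem s 5 u <= nmem s 5 (nmem s 4 0)].

Lemma ler_sum_subset (K K' : {set 'I_n}) :
  K \subset K' -> (\sum_(y in K) w y <= \sum_(y in K') w y)%R.
Proof.
move=> KK'; rewrite [leLHS]big_mkcond [leRHS]big_mkcond /=; apply: ler_sum => y _.
by case: ifP => [/(subsetP KK') ->|_] //; case: ifP.
Qed.

Lemma neighbors_inU1 S x u :
  neighbors_in e (x |: S) u =
    if e u x then x |: neighbors_in e S u else neighbors_in e S u.
Proof.
by apply/setP => y; case: ifP => ux; rewrite !inE; case: eqVneq => // ->;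
  rewrite ux ?andbF.
Qed.

(** A positive key places [x] in the neighborhood outside [S], and a maximum key is a maximum number
    of visited neighbors, so separation persists. *)
Lemma search_step (v : 'I_n) S s (x : 'I_n) :
    searching v S s -> picked s -> nmem s 4 0 = x ->
  x \in closed_nbhd v :\: S /\
  runs e (300 * n.+1) (Seq record (Seq visit pick_next)) s
    (fun s' => searching v (x |: S) s' /\ picked s').
Proof.
move=> [[sn sw s5] sv [outC outW outM] [SD sep sK sS sA]] [_ pos max] sx.
rewrite sx ltn_ord in pos max; have {}pos := pos isT.
have xDS : x \in closed_nbhd v :\: S by rewrite sK in pos; case: ifP pos.
have xS : x \notin S by move: xDS; rewrite inE => /andP[].
have xD : x \in closed_nbhd v by move: xDS; rewrite inE => /andP[].
have sep' : separated e (closed_nbhd v) (x |: S).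
  apply: separated_mcs => // [c cD hc|y yDS].
    apply: (wheel_free_closed_neighborhood (v := v) nowheel hc) => y /cD.
    by rewrite inE.
  by have := max y; rewrite !sK yDS xDS.
have cliqueN := separated_clique esym eirr sep xDS.
split=> //.
apply: (runs_weaken (T' := 100 * n.+1 + (100 * n.+1 + 100 * n.+1)) _ (fun _ q => q)).
  by lia.
apply: runs_seq (runs_frame (record_spec sn sx sS xS sw (sA x) cliqueN outC outW)) _.
move=> s1 [[fn1 fr1] [outC1 outW1 cand1 best1]].
have sn1 : nmem s1 0 0 = n by rewrite fn1.
have sx1 : nmem s1 4 0 = x by rewrite fn1.
have sw1 u : rmem s1 0 (nat_of_ord u) = w u by rewrite fr1.
apply: runs_seq (runs_frame (visit_spec e sn1 sx1 sw1)) _.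
move=> s2 [[fn2 fr2] [s25 s2K s2S s2A]].
have sn2 : nmem s2 0 0 = n by rewrite fn2.
have s5n2 : nmem s2 5 n = 0 by rewrite s25 fn1.
apply: runs_weaken (runs_frame (pick_next_spec e sn2 s5n2)) => //.
move=> s3 [[fn3 fr3] [le3 pos3 max3]].
have outE : output n s3 = output n s1.
  by apply/setP => u; rewrite !inE fn3 // fn2.
split; last by split=> [||u] //; rewrite [nmem s3 5]fn3.
split.
- by split=> [|u|]; rewrite ?fn3 // ?fr3 // ?fn2 // ?fr2.
- by rewrite fn3 // fn2 // fn1.
- split; first by rewrite outE.
    by rewrite outE fr3 // fr2.
  move=> K cK PK; rewrite fr3 // fr2 //.
  (* A clique in [x |: S] either avoids [x] and lies in [S], or lies in the clique that [record] has
     just compared. *)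
  case: (boolP (x \in K)) => xK; last first.
    apply: le_trans best1; apply: outM => //.
    case: PK => [|KS]; [by left|right].
    apply/subsetP => y yK; have := subsetP KS y yK; rewrite in_setU1.
    by case: eqVneq yK xK => [-> ->|].
  case: PK => [PK|KS]; first by apply: le_trans best1; apply: outM => //; left.
  apply: le_trans cand1; apply: ler_sum_subset => //.
  apply/subsetP => y yK; have := subsetP KS y yK; rewrite !in_setU1 inE.
  by case: eqVneq => //= yx ->; apply: cK => //; rewrite eq_sym.
- split=> //.
  + by rewrite subUset sub1set xD.
  + move=> u; rewrite fn3 // s2K fn1 // sK neighbors_inU1 !inE negb_or.
    case: eqVneq => [//|ux] /=; case: (_ && _) => //=.
    rewrite [e u x]esym; case: (e x u); rewrite ?addn0 // addn1.
    by rewrite cardsU1 inE (negbTE xS).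
  + move=> u; rewrite fn3 // s2S fn1 // sS in_setU1.
    by case: eqVneq.
  + move=> u; rewrite fr3 // s2A fr1 // sA neighbors_inU1 [e u x]esym.
    case: ifP => _; last by rewrite addr0.
    by rewrite big_setU1 ?inE ?(negbTE xS) //= addrC.
Qed.

(** Each iteration visits a new vertex of the closed neighborhood; 310 covers the body (300) and the
    test (7). *)
Lemma search_spec (v : 'I_n) s : scanned v s ->
  runs e (100 * n.+1 + (#|closed_nbhd v| * (310 * n.+1) + 7)) search s
    (fun s' => scanned v s' /\ optimal_on (fun K => exists2 u : 'I_n, u <= v & u \in K) s').
Proof.
move=> [[sn sw s5] sv [outC outW outM]].
apply: runs_seq (runs_frame (start_spec e sn sv)) _ => s1 [[fn1 fr1] [s1x s15 s1N]].
have outE : output n s1 = output n s by apply/setP => u; rewrite !inE fn1.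
pose D := closed_nbhd v.
pose J T s' := exists S : {set 'I_n},
  [/\ searching v S s', picked s' & T = #|D :\: S| * (310 * n.+1) + 7].
apply: (runs_while (Inv := J)).
- move=> T s2 [S [srch [le2 _ max2] ->]]; rewrite /= negbK.
  case: (srch) => [[sn2 sw2 s52] sv2 [outC2 outW2 outM2] [SD _ sK _ _]].
  rewrite sn2 => ge2; split; first by rewrite addnC.
  have {le2 ge2} x2 : nmem s2 4 0 = n by apply/eqP; rewrite eqn_leq le2.
  (* The loop stops at [x = n], of key 0; by maximality all keys are 0, so all of [D] is visited. *)
  have DS : D \subset S.
    apply/subsetP => u uD; have := max2 u; rewrite x2 s52 sK inE uD andbT.
    by case: (u \in S).
  (* A clique containing [v] lies in [D], hence in [S]. *)
  have DE K u : clique e K -> u \in K -> u <= v ->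
      (exists2 u : 'I_n, u < v & u \in K) \/ K \subset S.
    move=> cK uK; rewrite leq_eqVlt => /predU1P[/val_inj uv|uv]; last by left; exists u.
    right; apply: subset_trans DS; apply/subsetP => y yK; rewrite inE.
    by case: eqVneq => //= yv; apply: cK; rewrite -?uv // eq_sym uv.
  split; [split=> //; split=> // K cK [u uv uK]|split=> // K cK [u uv uK]];
    apply: outM2 => //; [exact: DE uK (ltnW uv)|exact: DE uK uv].
- move=> T s2 [S [srch pck ->]].
  case: (srch) => [[sn2 _ _] _ _ _]; rewrite /= sn2 -ltnNge => lt2.
  have [xDS step] := search_step srch pck (erefl : nmem s2 4 0 = Ordinal lt2).
  exists (300 * n.+1), (#|D :\: (Ordinal lt2 |: S)| * (310 * n.+1) + 7); split.
    rewrite [#|D :\: S|](cardsD1 (Ordinal lt2)) xDS setDDl (setUC S).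
    rewrite mulnDl [nat_of_bool _ * _]mul1n.
    by move: (#|_| * _) => a /=; lia.
  by apply: runs_weaken step => // s3 [srch3 pck3]; exists (Ordinal lt2 |: S).
(* All keys are at most 1 at the start, so [v] is a legitimate first pick. *)
- exists set0; rewrite setD0; split=> //; last first.
    split=> [|_|u]; rewrite s1x; first exact: ltnW.
      by have [-> _ _] := s1N v; rewrite eqxx.
    have [-> _ _] := s1N v; have [-> _ _] := s1N u; rewrite eqxx.
    by case: (_ || _).
  split; [split=> [|u|]| | |split].
  + by rewrite fn1.
  + by rewrite fr1.
  + by rewrite s15.
  + by rewrite fn1.
  + rewrite /optimal_on outE fr1 //; split=> // K cK [//|]; first exact: outM.
    rewrite subset0 => /eqP ->.
    by rewrite big_set0 outW sumr_ge0.
  + exact: sub0set.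
  + exact: separated0.
  + move=> u; have [-> _ _] := s1N u; rewrite setD0 inE; case: (_ || _) => //=.
    by congr _.+1; apply/eqP; rewrite eq_sym cards_eq0; apply/eqP/setP => y; rewrite !inE.
  + by move=> u; have [_ -> _] := s1N u; rewrite inE.
  + move=> u; have [_ _ ->] := s1N u.
    by rewrite big1 // => y; rewrite !inE.
Qed.

(** The handshake identity: each vertex counts itself and its degree. *)
Lemma sum_closed_nbhd : \sum_v #|closed_nbhd v| <= n + 2 * num_edges e.
Proof.
have card_le (v : 'I_n) : #|closed_nbhd v| <= 1 + #|[set u | e v u]|.
  have -> : closed_nbhd v = v |: [set u | e v u] by apply/setP => u; rewrite !inE.
  by rewrite cardsU1 leq_add2r; case: (_ \notin _).
apply: leq_trans (leq_sum _ (fun v _ => card_le v)) _.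
rewrite big_split /= sum1_card card_ord leq_add2l.
have -> : \sum_v #|[set u | e v u]| = #|[set xy : 'I_n * 'I_n | e xy.1 xy.2]|.
  rewrite -sum1_card (eq_bigr (fun v => \sum_(u | e v u) 1)); last first.
    by move=> v _; rewrite -sum1_card; apply: eq_bigl => u; rewrite inE.
  rewrite pair_big_dep /=; apply: eq_bigl => -[x y]; by rewrite inE.
pose E := [set xy : 'I_n * 'I_n | (xy.1 < xy.2) && e xy.1 xy.2].
have sub : [set xy : 'I_n * 'I_n | e xy.1 xy.2]
    \subset E :|: [set (xy.2, xy.1) | xy in E].
  apply/subsetP => -[x y]; rewrite !inE /= => xy; rewrite xy andbT.
  case: (ltngtP x y) => //= [yx|/val_inj xyE]; last by rewrite xyE eirr in xy.
  by apply/imsetP; exists (y, x) => //; rewrite inE /= yx esym.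
rewrite (leq_trans (subset_leq_card sub)) // (leq_trans (leq_card_setU _ _)) //.
by rewrite mul2n -addnn leq_add2l leq_imset_card.
Qed.

Lemma max_clique_spec :
  exists t s, [/\ exec e max_clique (init_state w) t s,
    max_weight_clique e w (output n s) &
    t <= 5000 * (maxn 1 n ^ 2 * maxn 1 (num_edges e))].
Proof.
(* The cost of one search, plus 13 for the test, the increment and the loop step. *)
pose c (v : 'I_n) := 100 * n.+1 + (#|closed_nbhd v| * (310 * n.+1) + 7) + 13.
pose J T s := exists2 k, scanned k s & k <= n /\ T = \sum_(v : 'I_n | k <= v) c v + 7.
pose Q s := max_weight_clique e w (output n s).
have ini : runs e (maxcost (NSet 2 (NConst 0) (NConst 0)) + (\sum_v c v + 7))
    max_clique (init_state w) Q.
  apply: runs_seq (runs_loop_free (Q := eq _) _ erefl) _ => // _ <-.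
  apply: (runs_while (Inv := J)).
  - move=> T s [k [[sn sw s5] sk [outC outW outM]] [le_kn ->]].
    rewrite /= sn sk negbK => le_nk; split; first by rewrite addnC.
    split=> // K cK; rewrite -outW.
    (* The empty clique meets no scanned vertex; nonnegativity of the weights settles it. *)
    have [->|[u uK]] := set_0Vmem K; first by rewrite big_set0 outW sumr_ge0.
    by apply: outM => //; exists u => //; exact: leq_trans le_nk.
  - move=> T s [k sck [le_kn ->]].
    case: (sck) => [[sn _ _] sk _]; rewrite /= sn sk -ltnNge => lt_kn.
    exists (100 * n.+1 + (#|closed_nbhd (Ordinal lt_kn)| * (310 * n.+1) + 7) + 6),
      (\sum_(v : 'I_n | k < v) c v + 7); split.
      rewrite [X in _ <= X + _](bigD1 (Ordinal lt_kn)) //=.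
      rewrite (eq_bigl (fun v : 'I_n => (k <= v) && (v != Ordinal lt_kn))).
        by rewrite /c; move: (\sum_(_ | _) _) (_ * (310 * _)) => S1 S2; lia.
      by move=> u; rewrite ltn_neqAle andbC -val_eqE /= eq_sym.
    have -> : 6 = maxcost (incr 2) by [].
    apply: runs_seq (search_spec (v := Ordinal lt_kn) sck) _ => s1 [sc1 opt1].
    apply: runs_loop_free => //; exists k.+1 => //.
    case: sc1 => [[sn1 sw1 s51] sk1 _]; split=> //; last by rewrite /= sk1 addn1.
  - exists 0; last by split=> //; congr (_ + _); apply: eq_bigl.
    split=> //; first by split=> //= u; rewrite /= valK.
    rewrite /optimal_on.
    have -> : output n (step e (NSet 2 (NConst 0) (NConst 0)) (init_state w)) = set0.
      by apply/setP => u; rewrite !inE.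
    by split=> //=; [move=> y z; rewrite inE|rewrite big_set0|move=> K _ []].
have [t [s [x tT q]]] := ini; exists t, s; split=> //.
apply: leq_trans tT _.
have -> : \sum_v c v = (\sum_v #|closed_nbhd v|) * (310 * n.+1) + n * (100 * n.+1 + 20).
  rewrite /c big_distrl /= -[X in _ + X * _]card_ord -sum_nat_const -big_split /=.
  by apply: eq_bigr => v _; move: (#|_| * _) => k; lia.
have := sum_closed_nbhd; move: (\sum_v _) (num_edges e) => D M leD.
rewrite expnS expn1; set n1 := maxn 1 n; set m1 := maxn 1 M.
have n11 : 0 < n1 by exact: leq_maxl.
have m11 : 0 < m1 by exact: leq_maxl.
have len : n <= n1 by exact: leq_maxr.
have leM : M <= m1 by exact: leq_maxr.
(* The sum [n + 2 * M] becomes a product because [n1] and [m1] are at least 1. The final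
   coefficients 1860 and 220, with the additive 10, stay below 5000. *)
have le_D : D <= 3 * (n1 * m1).
  have : n1 <= n1 * m1 by exact: leq_pmulr.
  have : m1 <= n1 * m1 by exact: leq_pmull.
  by lia.
have le1 : D * (310 * n.+1) <= 3 * (n1 * m1) * (620 * n1) by apply: leq_mul => //; lia.
have le2 : n * (100 * n.+1 + 20) <= n1 * (220 * n1) by apply: leq_mul => //; lia.
have le3 : n1 * n1 <= n1 * n1 * m1 by exact: leq_pmulr.
have le4 : 1 <= n1 * n1 by rewrite muln_gt0 n11.
have e1 : 3 * (n1 * m1) * (620 * n1) = 1860 * (n1 * n1 * m1) by lia.
have e2 : n1 * (220 * n1) = 220 * (n1 * n1) by lia.
rewrite e1 in le1; rewrite e2 in le2; move: le1 le2 le3 le4 => /=.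
by move: (n1 * n1 * m1) (n1 * n1) (D * _) (n * _) => ? ? ? ?; lia.
Qed.

End Correctness.

Theorem theorem3p2 (R : realType) :
  exists (p : cmd) (C : nat),
    forall (n : nat) (e : rel 'I_n) (w : 'I_n -> R),
      symmetric e -> irreflexive e ->
      theta_wheel_free e ->
      (forall v : 'I_n, (0 <= w v)%R) ->
      exists (t : nat) (s : state R),
        [/\ exec e p (init_state w) t s,
            max_weight_clique e w (output n s) &
            t <= C * (maxn 1 n ^ 2 * maxn 1 (num_edges e))].
Proof.
exists max_clique, 5000 => n e w esym eirr [_ nowheel] w_ge0.
exact: max_clique_spec.
Qed.
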